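(* Let $L$ be an inverse-property loop, and let $B\subseteq L$ satisfy $B=B^{-1}$. Then for every $x\in L$, $(xB)/B\subseteq(xB)B$. Consequently, if $K$ is a real number and $A,B\subseteq L$ are finite nonempty subsets with $B=B^{-1}$ and $|AB|\le K|B|$, then there exists $X\subseteq A$ with $|X|\le K$ such that $A\subseteq\bigcup_{x\in X}(xB)B$.
   Context: A loop is a set with a binary operation having a two-sided identity $1$ such that for all $a,b$ the equations $ax=b$ and $ya=b$ have unique solutions. An inverse-property loop is a loop in which every element $x$ has a two-sided inverse $x^{-1}$ with $x^{-1}(xy)=y=(yx)x^{-1}$ for all $y$. For $u,v$ in a loop, $u/v$ denotes the unique $y$ with $yv=u$. For subsets $U,V$ of a loop, $UV=\{uv:u\in U,v\in V\}$ and $U/V=\{u/v:u\in U,v\in V\}$; $xB=\{xb:b\in B\}$ and $B^{-1}=\{b^{-1}:b\in B\}$. *)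

(* Defs.v *)
From HB Require Import structures.
From mathcomp Require Import all_boot all_order finmap.
From mathcomp Require Import boolp classical_sets functions cardinality reals.

Set Implicit Arguments.
Unset Strict Implicit.
Unset Printing Implicit Defensive.

Local Open Scope classical_set_scope.
Local Open Scope group_scope.

HB.mixin Record UMagma_isLoop L of UMagma L := {
  loop_ldivP : forall a b : L, exists! x, a * x = b;
  loop_rdivP : forall a b : L, exists! y, y * a = b
}.

#[short(type="loopType")]
HB.structure Definition Loop := {L of UMagma_isLoop L & UMagma L}.

HB.mixin Record Loop_isIPLoop L of Loop L := {
  linv : L -> L;
  linv_mulV : forall x : L, linv x * x = 1;
  linv_mulVr : forall x : L, x * linv x = 1;
  linv_mulK : forall x y : L, linv x * (x * y) = y;
  linv_mulKr : forall x y : L, (y * x) * linv x = y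
}.

#[short(type="ipLoopType")]
HB.structure Definition IPLoop := {L of Loop_isIPLoop L & Loop L}.

Lemma rdiv_exists (L : loopType) (u v : L) : exists y, y * v = u.
Proof. by have [y [yv _]] := loop_rdivP v u; exists y. Qed.

(* The library's [u / v] in group_scope unfolds to [u * v^-1]; the quotient of
   a loop is instead the solution [y] of [y * v = u]. *)
Definition rdiv (L : loopType) (u v : L) : L := sval (cid (rdiv_exists u v)).

Lemma rdivK (L : loopType) (u v : L) : rdiv u v * v = u.
Proof. exact: (svalP (cid (rdiv_exists u v))). Qed.

Lemma rdiv_unique (L : loopType) (u v y : L) : y * v = u -> y = rdiv u v.
Proof.
have [z [_ zP]] := loop_rdivP v u => yv.
by rewrite -(zP _ yv) -(zP _ (rdivK u v)).
Qed.

Definition mulset (L : loopType) (U V : set L) : set L :=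
  [set u * v | u in U & v in V].

Definition rdivset (L : loopType) (U V : set L) : set L :=
  [set rdiv u v | u in U & v in V].

Definition lmulset (L : loopType) (x : L) (B : set L) : set L :=
  [set x * b | b in B].

Definition invset (L : ipLoopType) (B : set L) : set L := [set linv b | b in B].

(* Meaningful for finite sets only: it is 0 on infinite ones. *)
Definition setcard (T : choiceType) (A : set T) : nat := #|` fset_set A|%fset.

(* Main.v *)
Require Import Defs.
From mathcomp Require Import all_boot all_order all_algebra finmap.
From mathcomp Require Import boolp classical_sets functions cardinality reals.

(** In an inverse-property loop [u / v = u v^-1], which gives the inclusion.
    For the covering, take [X] a maximal subset of [A] such that the translates
    [xB], [x] in [X], are pairwise disjoint: they are [|X|] disjoint subsets of
    [AB] of size [|B|], so [|X| |B| <= |AB| <= K |B|]; and by maximality every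
    [aB] meets some [xB], so that [a] lies in [(xB)/B]. *)

Import Order.TTheory GRing.Theory Num.Theory.

Local Open Scope classical_set_scope.
Local Open Scope ring_scope.

Lemma loop_mulI (L : loopType) (a : L) : injective (fun x => (a * x)%g).
Proof.
move=> x y /= axy; have [z [_ zP]] := loop_ldivP a (a * y)%g.
by rewrite -(zP _ axy); apply: zP.
Qed.

Lemma linvK (L : ipLoopType) : involutive (@linv L).
Proof. by move=> x; apply: (@loop_mulI _ (linv x)); rewrite linv_mulVr linv_mulV. Qed.

(** The right inverse property at [linv v] cancels [linv (linv v)], which is [v], so [u * linv v]
    solves [y * v = u]. *)
Lemma rdivE (L : ipLoopType) (u v : L) : rdiv u v = (u * linv v)%g.
Proof. by apply/esym/rdiv_unique; rewrite -{2}(linvK _ v) linv_mulKr. Qed.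

Lemma rdivset_mulset (L : ipLoopType) (U B : set L) :
  B = invset B -> rdivset U B `<=` mulset U B.
Proof.
move=> BV _ [u Uu [b Bb <-]]; exists u => //; exists (linv b).
  by rewrite BV; exists b.
by rewrite rdivE.
Qed.

(** Greedy choice along [s]: the head joins the net of the tail only if it is related to no member
    of it. Reflexivity then lets it cover itself, and symmetry separates it from the others in both
    orders. *)
Lemma separated_net (T : eqType) (r : T -> T -> Prop) (s : seq T) :
    (forall x, r x x) -> (forall x y, r x y -> r y x) ->
  exists X : seq T, [/\ uniq X, {subset X <= s},
    {in X &, forall x y, r x y -> x = y} &
    {in s, forall a, exists2 x, x \in X & r a x}].
Proof.
move=> rxx rC; elim: s => [|a s [X [uX Xs sepX covX]]]; first by exists [::].
have [[x xX rax]|nra] := pselect (exists2 x, x \in X & r a x).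
  exists X; split=> // [y yX|y]; first by rewrite inE Xs ?orbT.
  by rewrite inE => /predU1P[->|/covX//]; exists x.
exists (a :: X); split=> [|y|y z|y].
- by rewrite /= uX andbT; apply/negP => aX; apply: nra; exists a.
- by rewrite !inE => /predU1P[->|/Xs->]; rewrite ?eqxx ?orbT.
- rewrite !inE => /predU1P[->|yX] /predU1P[->|zX] // ryz; last exact: sepX.
    by case: nra; exists z.
  by case: nra; exists y => //; apply: rC.
- rewrite inE => /predU1P[->|/covX[x xX ryx]]; first by exists a; rewrite ?mem_head.
  by exists x; rewrite // inE xX orbT.
Qed.

Lemma setcard_seq (T : choiceType) (s : seq T) :
  uniq s -> setcard [set` s] = size s.
Proof.
move=> us; have -> : [set` s] = [set` [fset x in s]%fset].
  by apply/seteqP; split=> x /=; rewrite inE.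
by rewrite /setcard set_fsetK card_fseq undup_id.
Qed.

(** Phrased with [enum_fset] because the net and the products are handled as sequences. *)
Lemma mem_fset_setP {T : choiceType} {A : set T} {x : T} :
  finite_set A -> reflect (A x) (x \in enum_fset (fset_set A)).
Proof.
move=> finA; rewrite -[_ \in enum_fset _]/(x \in fset_set A) in_fset_set //.
exact: asboolP.
Qed.

Theorem proposition3p14 (R : realType) (L : ipLoopType) :
  (forall B : set L, B = invset B ->
     forall x : L, rdivset (lmulset x B) B `<=` mulset (lmulset x B) B)
  /\
  (forall (K : R) (A B : set L),
     finite_set A -> A !=set0 -> finite_set B -> B !=set0 ->
     B = invset B ->
     (setcard (mulset A B))%:R <= K * (setcard B)%:R ->
     exists X : set L,
       [/\ X `<=` A, (setcard X)%:R <= K &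
           A `<=` \bigcup_(x in X) mulset (lmulset x B) B]).
Proof.
split=> [B BV x|K A B finA _ finB [b0 Bb0] BV cardAB]; first exact: rdivset_mulset.
(* The translates [xB] and [yB] intersect; this is reflexive because [B] contains [b0]. *)
pose meets x y := exists b c : L, [/\ B b, B c & (x * b)%g = (y * c)%g].
have [||X [uX XA sepX covX]] := @separated_net L meets (fset_set A).
- by move=> x; exists b0, b0.
- by move=> x y [b [c [Bb Bc xbyc]]]; exists c, b.
exists [set` X]; split=> [x /= /XA /(mem_fset_setP finA)//||a Aa].
- have cardB : (0 < setcard B)%N.
    rewrite /setcard cardfs_gt0; apply/fset0Pn; exists b0.
    exact/mem_fset_setP.
  (* Finiteness makes [setcard] the true size of [AB] rather than its default 0. *)
  have finAB : finite_set (mulset A B) by exact: finite_image2.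
  rewrite setcard_seq // -(@ler_pM2r _ (setcard B)%:R) ?ltr0n //.
  apply: le_trans cardAB; rewrite -natrM ler_nat.
  (* [|X| |B|] is the length of the list of all products [x * b], a duplicate-free list inside
     [AB]. *)
  rewrite -(size_allpairs (fun x b => (x * b)%g)).
  apply: uniq_leq_size => [|_ /allpairsP[[x b] /= [xX bB ->]]].
    apply: allpairs_uniq => // p q /allpairsP[[x b] /= [xX bB ->]].
    move=> /allpairsP[[y c] /= [yX cB ->]] /= xbyc.
    (* [x * b = y * c] says that the two translates meet, so separation applies; left cancellation
       then gives [b = c]. *)
    have xy : x = y.
      by apply: sepX => //; exists b, c; split=> //; apply/mem_fset_setP.
    by move: xbyc; rewrite xy => /loop_mulI ->.
  apply/mem_fset_setP => //; exists x; first exact/mem_fset_setP/XA.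
  by exists b => //; apply/mem_fset_setP.
- have [|x xX [b [c [Bb Bc abxc]]]] := covX a; first exact/mem_fset_setP.
  exists x => //; apply: (rdivset_mulset L _ B BV).
  (* From [a * b = x * c], [a] is the quotient of [x * c] by [b]. *)
  by exists (x * c)%g; [exists c|exists b => //; apply/esym/rdiv_unique].
Qed.
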